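(* Let $G$ be a finite group (acting on $\mathbb{R}^d$) that leaves $\mathbb{Z}^d$ invariant. Let $M>0$ and let $\mathcal{M}=\{\Omega\subset\mathbb{R}^d:|\Omega|=M\text{ and }g\Omega=\Omega\ \ \forall g\in G\}$. Let $\{f_i\}_{i=1}^m\subset L^2(\mathbb{R}^d)$ and $$\varphi(\xi)=\sum_{i=1}^m|\widehat f_i(\xi)|^2,\qquad \Phi_G(\xi)=\sum_{g\in G}\sum_{i=1}^m|\widehat f_i(g\xi)|^2 .$$ Let $D\subset\mathbb{R}^d$ be a measurable section of the quotient of $\mathbb{R}^d$ by the action of $G$. Assume that $$\Omega_0\in\operatorname{argmax}\Big\{\int_\Omega\varphi:\ \Omega\in\mathcal{M}\Big\}\quad\text{and}\quad\Sigma_0\in\operatorname{argmax}\Big\{\int_\Sigma\Phi_G:\ \Sigma\subseteq D,\ |\Sigma|=M/(\#G)\Big\}.$$ Then $$\int_{\Omega_0}\varphi=\int_{\Sigma_0}\Phi_G .$$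
   Context: $G$ acts faithfully on $\mathbb{R}^d$ by continuous (linear) automorphisms with $g\mathbb{Z}^d=\mathbb{Z}^d$ for all $g\in G$. $|\cdot|$ is Lebesgue measure, $\#G$ is the order of $G$, and all sets $\Omega,\Sigma$ are measurable. The Fourier transform is $\widehat f(\omega)=\int_{\mathbb{R}^d}f(x)e^{-2\pi i\langle x,\omega\rangle}\,dx$ extended to $L^2(\mathbb{R}^d)$. The equivalence relation is $x\sim_Gy$ iff $x=gy$ for some $g\in G$; a measurable section $D$ of $\mathbb{R}^d/\!\sim_G$ is a measurable set such that $\mathbb{R}^d=\bigcup_{g\in G}gD$ with the union being disjoint, up to Lebesgue null sets. $\operatorname{argmax}$ denotes the set of maximizers. *)

(* Defs.v *)
From HB Require Import structures.
From mathcomp Require Import all_boot all_order all_algebra all_fingroup.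
From mathcomp Require Import mxrepresentation.
From mathcomp Require Import complex.
From mathcomp Require Import all_classical all_reals all_analysis.

Set Implicit Arguments.
Unset Strict Implicit.
Unset Printing Implicit Defensive.
Import Order.TTheory GRing.Theory Num.Theory.
Import numFieldNormedType.Exports.

Local Open Scope classical_set_scope.
Local Open Scope ring_scope.
Local Open Scope complex_scope.

Definition cV_display : measure_display. Proof. exact: default_measure_display. Qed.

(* The product sigma-algebra on R^n (vectors are columns). *)
Section cV_measurable.
Variables (R : realType) (n : nat).

Let coord (i : 'I_n) (x : 'cV[R]_n) : measurableTypeR R := x i 0.

Let cV_set0 : g_sigma_preimage coord set0.
Proof. exact: sigma_algebra0. Qed.

Let cV_setC A : g_sigma_preimage coord A -> g_sigma_preimage coord (~` A).
Proof. exact: sigma_algebraC. Qed.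

Let cV_bigcup (F : (set 'cV[R]_n)^nat) : (forall i, g_sigma_preimage coord (F i)) ->
  g_sigma_preimage coord (\bigcup_i (F i)).
Proof. exact: sigma_algebra_bigcup. Qed.

HB.instance Definition _ := @isMeasurable.Build cV_display
  'cV[R]_n (g_sigma_preimage coord) cV_set0 cV_setC cV_bigcup.

End cV_measurable.

Definition cV_cons (R : realType) (n : nat)
  (p : measurableTypeR R * 'cV[R]_n) : 'cV[R]_n.+1 :=
  col_mx (p.1%:M : 'cV[R]_1) p.2.


Definition cV_uncons (R : realType) (n : nat) (x : 'cV[R]_n.+1) :
  measurableTypeR R * 'cV[R]_n := (x 0 0, \col_i x (lift 0 i) 0).

Lemma cV_consK (R : realType) (n : nat) : cancel (@cV_cons R n) (@cV_uncons R n).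
Proof.
case=> a v; rewrite /cV_uncons /cV_cons /=; congr pair.
  have -> : 0 = lshift n 0 :> 'I_(1 + n) by exact: val_inj.
  by rewrite (col_mxEu (a%:M : 'cV[R]_1)) mxE.
apply/colP => i; rewrite mxE.
have -> : lift 0 i = rshift 1 i :> 'I_(1 + n) by exact: val_inj.
by rewrite (col_mxEd (a%:M : 'cV[R]_1)).
Qed.

Lemma measurable_cV_coord (R : realType) (n : nat) (i : 'I_n) :
  measurable_fun [set: 'cV[R]_n] (fun x => x i 0 : measurableTypeR R).
Proof.
move=> _ B mB; apply: sub_sigma_algebra; rewrite -bigcup_seq.
by exists i; [rewrite /= mem_index_enum|exists B].
Qed.

Lemma measurable_fun_cV (d : measure_display) (T : measurableType d)
    (R : realType) (n : nat) (f : T -> 'cV[R]_n) :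
  (forall i, measurable_fun [set: T] (fun t => f t i 0 : measurableTypeR R)) ->
  measurable_fun [set: T] f.
Proof.
move=> mf; pose G := (\big[setU/set0]_(i < n) preimage_set_system setT
  (fun x : 'cV[R]_n => x i 0 : measurableTypeR R) measurable).
apply: (@measurability _ _ _ _ _ _ G) => //.
move=> _ [C GC <-]; move: GC; rewrite /G -bigcup_seq => -[i _ [B mB <-]].
rewrite !setTI -[X in measurable X]setTI.
by have /(_ measurableT _ mB) := mf i.
Qed.

Lemma measurable_cV_cons (R : realType) (n : nat) :
  measurable_fun [set: measurableTypeR R * 'cV[R]_n] (@cV_cons R n).
Proof.
apply: measurable_fun_cV => i; have [j ->|->] := unliftP 0 i.
  rewrite (_ : (fun p => _) = (fun v : 'cV[R]_n => v j 0 : measurableTypeR R) \o snd).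
    exact: measurableT_comp (@measurable_cV_coord R n j) measurable_snd.
  by apply/funext => p /=; rewrite -[p in RHS](@cV_consK R n) /= mxE.
rewrite (_ : (fun p => _) = fst); first exact: measurable_fst.
by apply/funext => p; rewrite -[p in RHS](@cV_consK R n).
Qed.

Lemma measurable_cV_uncons (R : realType) (n : nat) :
  measurable_fun [set: 'cV[R]_n.+1] (@cV_uncons R n).
Proof.
apply/measurable_fun_pairP; split.
exact: measurable_cV_coord.
apply: measurable_fun_cV => i /=.
under eq_fun do rewrite mxE.
exact: measurable_cV_coord.
Qed.

Section cV_lebesgueS.
Local Open Scope ereal_scope.
Context (R : realType) (n : nat) (mu : {sigma_finite_measure set 'cV[R]_n -> \bar R}).

Definition cV_lebesgueS : set 'cV[R]_n.+1 -> \bar R :=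
  pushforward (lebesgue_measure \x mu) (@cV_cons R n).

Let nu := measure_function_pushforward__canonical__measure_function_Measure
  (lebesgue_measure \x mu) (@measurable_cV_cons R n).

HB.instance Definition _ := isMeasure.Build _ _ _ cV_lebesgueS
  (measure0 nu) (measure_ge0 nu) (@measure_semi_sigma_additive _ _ _ nu).

Let cV_lebesgueS_sigma_finite : sigma_finite setT cV_lebesgueS.
Proof.
(* The canonical sigma_finite_measure instance that unification finds for a product
   applies to finite measures only. *)
have [F FT mF] : sigma_finite setT (lebesgue_measure \x mu).
  have /sigma_finiteP[F [FT ndF Foo]] := sigma_finiteT (@lebesgue_measure R).
  have /sigma_finiteP[H [HT ndH Hoo]] := sigma_finiteT mu.
  exists (fun k => F k `*` H k).
    rewrite -setXTT FT HT; apply/seteqP; split=> [[x y] /= [[i _ Fx] [j _ Hy]]|].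
      exists (maxn i j) => //; split => /=.
      - by move: x Fx; exact/subsetPset/ndF/leq_maxl.
      - by move: y Hy; exact/subsetPset/ndH/leq_maxr.
    by move=> [x y] [k _ []/= ? ?]; split; exists k.
  move=> k; have [mFk Fk] := Foo k; have [mHk Hk] := Hoo k.
  split; first exact: measurableX.
  by rewrite product_measure1E// lte_mul_pinfty// ge0_fin_numE.
exists (fun k => @cV_uncons R n @^-1` F k).
  by rewrite -preimage_bigcup -FT preimage_setT.
move=> k; have [mFk Fk] := mF k; split.
  by rewrite -[X in measurable X]setTI; exact: measurable_cV_uncons.
rewrite /cV_lebesgueS /pushforward -comp_preimage.
by rewrite (_ : _ \o _ = id) ?preimage_id//; apply/funext => p; exact: cV_consK.
Qed.

HB.instance Definition _ := Measure_isSigmaFinite.Build _ _ _ cV_lebesgueS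
  cV_lebesgueS_sigma_finite.

End cV_lebesgueS.

Fixpoint cV_lebesgue (R : realType) (n : nat) :
    {sigma_finite_measure set 'cV[R]_n -> \bar R} :=
  match n with
  | 0 => \d_(0 : 'cV[R]_0)
  | n.+1 => cV_lebesgueS (cV_lebesgue R n)
  end.

(* Lebesgue measure on R^n: the Caratheodory completion of the product measure, so
   measurability in [lebesgue_space R n] is Lebesgue measurability. *)
Definition lebesgue_space (R : realType) (n : nat) :=
  caratheodory_type ((cV_lebesgue R n)^*)%mu.

HB.instance Definition _ (R : realType) (n : nat) :=
  Measurable.on (lebesgue_space R n).

Definition lebesgue (R : realType) (n : nat) : set (lebesgue_space R n) -> \bar R :=
  @completed_measure_extension _ _ _ (cV_lebesgue R n).

HB.instance Definition _ (R : realType) (n : nat) := Measure.on (@lebesgue R n).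

Definition argmax (T : Type) (R : realType) (F : T -> \bar R) (S : set T) : set T :=
  [set x | S x /\ forall y, S y -> (F y <= F x)%E].

Section fourier.
Context (R : realType) (d : nat).
Implicit Types (f F : lebesgue_space R d -> R[i]).

Definition dotcV (x w : 'cV[R]_d) : R := \sum_(i < d) x i 0 * w i 0.

(* e^{it} *)
Definition expi (t : R) : R[i] := cos t +i* sin t.

Definition cmeasurable f : Prop :=
  measurable_fun [set: lebesgue_space R d] (fun x => complex.Re (f x)) /\
  measurable_fun [set: lebesgue_space R d] (fun x => complex.Im (f x)).

Definition cLnorm (p : \bar R) f : \bar R :=
  'N[@lebesgue R d]_p[EFin \o (@Normc.normc R \o f)]%E.

Definition cLp (p : \bar R) f : Prop := cmeasurable f /\ (cLnorm p f < +oo)%E.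

Definition cintegral f : R[i] :=
  (\int[@lebesgue R d]_x complex.Re (f x)) +i*
  (\int[@lebesgue R d]_x complex.Im (f x)).

Definition fourier f (w : 'cV[R]_d) : R[i] :=
  cintegral (fun x => f x * expi (- (2 * pi * dotcV x w))).

(* For f in L^2: F represents the L^2 Fourier transform of f, i.e. the value at f
   of the L^2-continuous extension of [fourier] from the intersection of L^1 and
   L^2. The class of F modulo null sets is determined by f (Plancherel), F is not. *)
Definition is_fourierL2 f F : Prop :=
  cLp 2%:E F /\
    exists u : (lebesgue_space R d -> R[i])^nat,
      [/\ forall k, cLp 1%:E (u k) /\ cLp 2%:E (u k),
          (fun k => cLnorm 2%:E (u k \- f)) @ \oo --> 0%E &
          (fun k => cLnorm 2%:E (fourier (u k) \- F)) @ \oo --> 0%E].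

End fourier.

Section lattice_action.
Context (R : realType) (gT : finGroupType) (G : {group gT}) (d : nat).
Context (rG : mx_representation R G d).
Implicit Types (A D : set (lebesgue_space R d)).

(* Since rG (g * h) = rG g *m rG h, this is a left action on columns. *)
Definition lin_act (g : gT) (x : lebesgue_space R d) : lebesgue_space R d :=
  (rG g *m x : 'cV[R]_d).

Definition int_lattice : set (lebesgue_space R d) :=
  [set x : 'cV[R]_d | forall i, x i 0 \is a Num.int].

(* Both the covering and the disjointness hold up to null sets. *)
Definition is_section D : Prop :=
  [/\ measurable D,
      (@lebesgue R d).-negligible (~` \bigcup_(g in [set` G]) (lin_act g @` D)) &
      forall g h, g \in G -> h \in G -> g != h ->
        (@lebesgue R d).-negligible ((lin_act g @` D) `&` (lin_act h @` D))].

End lattice_action.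

(* Main.v *)
Require Import Defs.
From mathcomp Require Import all_boot all_order all_algebra all_fingroup.
From mathcomp Require Import mxrepresentation complex.
From mathcomp Require Import all_classical all_reals all_analysis.
From mathcomp Require Import measurable_realfun ring lra.

Set Implicit Arguments.
Unset Strict Implicit.
Unset Printing Implicit Defensive.
Import Order.TTheory GRing.Theory Num.Theory.
Import numFieldNormedType.Exports.

Local Open Scope classical_set_scope.
Local Open Scope ring_scope.
Local Open Scope complex_scope.

(** The finite group acts on the frequency space by linear maps, and a linear
    map of finite order preserves Lebesgue measure.  Granting this, let [D] be a
    section, so that the translates [gD] tile the space up to null sets.

    - An invariant set [Omega] is tiled by the translates of [Omega `&` D], and
      conversely any [Sigma `<=` D] generates the invariant set
      [\bigcup_g (g Sigma)].
    - In both situations, splitting along the tiles and changing variables in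
      each of them gives that the integral of [phi] over [Omega] is the integral
      over [Sigma] of [\sum_g phi (g x)] ([integral_tiling]); for [phi = 1] this
      says that [Omega] has [#|G|] times the measure of [Sigma]
      ([measure_tiling]).

    Hence the two variational problems have the same sets of attained values,
    and each maximum bounds the other ([argmax_tiling]).

    That a linear bijection [T] of finite order preserves the Lebesgue measure
    [mu] needs no determinant.  Translation invariance alone shows, by Fubini,
    that [mu (T^-1 A) * mu C = mu A * mu (T^-1 C)] for symmetric [C]
    ([cV_lebesgue_preimage_proportional], uniqueness of Haar measure); with [C]
    the unit cube, [T] scales all measures by one and the same ratio, and
    iterating until [T] comes back to the identity shows that this ratio is 1
    ([cV_lebesgue_preimage_finite_order]).  The invariance
    passes to the completed measure because a measure preserving bijection
    preserves the outer measure, hence also Caratheodory measurability. *)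

(** * Translation invariance of Lebesgue measure on column vectors *)

Lemma lebesgue_measure_shift (R : realType) (a : R)
    (A : set (measurableTypeR R)) : measurable A ->
  lebesgue_measure ((fun x : measurableTypeR R => x + a : measurableTypeR R) @^-1` A)
  = lebesgue_measure A.
Proof.
move=> mA.
have ms : measurable_fun setT
  (fun x : measurableTypeR R => x + a : measurableTypeR R).
  exact: measurable_funD.
pose nu := measure_function_pushforward__canonical__measure_function_Measure
  lebesgue_measure ms.
suff : lebesgue_measure A = nu A by [].
apply: lebesgue_measure_unique => //= _ [[x y]] _ <-.
rewrite /pushforward /=.
rewrite (_ : _ @^-1` _ = `]x - a, y - a]%classic); last first.
  by apply/seteqP; split=> t /=; rewrite !in_itv /= ltrBlDr lerBrDr.
rewrite !lebesgue_measure_itv/= !lte_fin ltrD2r; case: ifP => // _.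
by congr (_%:E); ring.
Qed.

Lemma measurable_cV_preimage (R : realType) d (T : measurableType d) (n : nat)
    (f : T -> 'cV[R]_n) A :
  measurable_fun setT f -> measurable A -> measurable (f @^-1` A).
Proof. by move=> mf mA; rewrite -[X in measurable X]setTI; exact: mf. Qed.

Lemma cV_cons_head (R : realType) (n : nat) (p : measurableTypeR R * 'cV[R]_n) :
  cV_cons p 0 0 = p.1.
Proof. by rewrite -[in RHS](cV_consK p). Qed.

Lemma cV_cons_tail (R : realType) (n : nat) (p : measurableTypeR R * 'cV[R]_n) i :
  cV_cons p (lift 0 i) 0 = p.2 i 0.
Proof. by rewrite -[in RHS](cV_consK p) /= mxE. Qed.

(** Induction on the dimension: a shift of [R * 'cV_n] acts on the sections over
    the first coordinate by shifting each of them and reindexing the family. *)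
Lemma cV_lebesgue_shift (R : realType) (n : nat) (v : 'cV[R]_n)
    (A : set 'cV[R]_n) :
  measurable A ->
  cV_lebesgue R n ((fun w => w + v) @^-1` A) = cV_lebesgue R n A.
Proof.
elim: n v A => [|n IHn] v A mA.
  have -> : (fun w => w + v) = id.
    by apply/funext => w; apply/colP => -[].
  by rewrite preimage_id.
pose v0 := v 0 0 : R; pose v' := \col_i v (lift 0 i) 0 : 'cV[R]_n.
have consD p : cV_cons p + v = @cV_cons R n (p.1 + v0, p.2 + v').
  apply/colP => i; rewrite mxE.
  by have [j ->|->] := unliftP 0 i; rewrite ?cV_cons_head ?cV_cons_tail // !mxE.
pose B := (@cV_cons R n) @^-1` A.
have mB : measurable B by exact: measurable_cV_preimage (@measurable_cV_cons R n) mA.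
rewrite /= /cV_lebesgueS /pushforward /=.
rewrite /product_measure1 /=.
transitivity (\int[@lebesgue_measure R]_(a in setT)
   cV_lebesgue R n (xsection B (a + v0)%R))%E.
  apply: eq_integral => a _ /=.
  rewrite -[RHS](IHn v'); last exact: measurable_xsection.
  congr (cV_lebesgue R n _); apply/seteqP; split=> w /=;
   by rewrite /xsection /= !inE /B /= consD.
pose s (x : measurableTypeR R) : measurableTypeR R := x + v0.
have ms : measurable_fun setT s by exact: measurable_funD.
transitivity (\int[pushforward (@lebesgue_measure R) s]_(a in setT)
   cV_lebesgue R n (xsection B a))%E.
  rewrite ge0_integral_pushforward //.
  exact: measurable_fun_xsection.
apply: (eq_measure_integral (@lebesgue_measure R)) => C mC _.
exact: lebesgue_measure_shift.
Qed.

(** * Linear maps of finite order preserve Lebesgue measure *)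

(** A reference set that is symmetric under [x |-> - x] and has positive finite
    measure. *)
Definition unit_cube (R : realType) (n : nat) : set 'cV[R]_n :=
  [set x | forall i, `|x i 0| <= 1].
Arguments unit_cube : clear implicits.

Lemma measurable_unit_cube (R : realType) n : measurable (unit_cube R n).
Proof.
rewrite (_ : unit_cube R n = \bigcap_(i in [set: 'I_n])
  ((fun x : 'cV[R]_n => x i 0 : measurableTypeR R) @^-1` `[-1, 1]%classic)).
  apply: fin_bigcap_measurable => // i _; rewrite -[X in measurable X]setTI.
  apply: measurable_cV_coord => //; exact: measurable_itv.
apply/seteqP; split=> x /= xC i.
  by move=> _; rewrite /= in_itv /= -ler_norml.
by have := xC i I; rewrite /= in_itv /= -ler_norml.
Qed.

Lemma unit_cube_measure (R : realType) n :
  (cV_lebesgue R n (unit_cube R n) = (2 ^+ n)%:E)%E.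
Proof.
elim: n => [|n IHn].
  by rewrite /= diracE mem_set //= => -[].
rewrite /= /cV_lebesgueS /pushforward.
rewrite (_ : _ @^-1` _ = `[-1, 1]%classic `*` unit_cube R n); last first.
  apply/seteqP; split=> -[a w] /= aw.
    split=> [|i].
      by rewrite /= in_itv /= -ler_norml; have := aw 0; rewrite cV_cons_head.
    by have := aw (lift 0 i); rewrite cV_cons_tail.
  move=> i; have [j ->|->] := unliftP 0 i; rewrite ?cV_cons_head ?cV_cons_tail /=.
    exact: aw.2.
  by have := aw.1; rewrite in_itv /= -ler_norml.
rewrite product_measure1E /=; last 2 first.
  exact: measurable_itv.
  exact: measurable_unit_cube.
rewrite IHn lebesgue_measure_itv /= lte_fin ifT; last lra.
by rewrite -EFinD -EFinM exprS; congr (_ * _)%:E; ring.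
Qed.

Section haar.
Context (R : realType) (n : nat) (T : 'cV[R]_n -> 'cV[R]_n).
Hypotheses (mT : measurable_fun setT T) (TD : {morph T : x y / x + y}).
Hypothesis Tsurj : forall x, exists v, T v = x.
Local Notation mu := (cV_lebesgue R n).

(** The two sides are the measures, computed by Fubini, of the sets [E'] and [E]
    below, one section at a time.  The sections of [E'] and [E] at a fixed [x]
    are translates of each other, by a [T]-preimage of [x], so both sets have
    the same measure. *)
Lemma cV_lebesgue_preimage_proportional (A C : set 'cV[R]_n) :
  measurable A -> measurable C -> (forall x, C x -> C (- x)) ->
  (mu (T @^-1` A) * mu C = mu A * mu (T @^-1` C))%E.
Proof.
move=> mA mC Csym.
pose E := [set p : 'cV[R]_n * 'cV[R]_n | A (p.1 + T p.2) /\ C (T p.2)].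
pose E' := [set p : 'cV[R]_n * 'cV[R]_n | A (T p.2) /\ C (T p.2 - p.1)].
have mT2 : measurable_fun setT (fun p : 'cV[R]_n * 'cV[R]_n => T p.2).
  exact: measurableT_comp mT measurable_snd.
have mlin (a b : R) : measurable_fun setT
    (fun p : 'cV[R]_n * 'cV[R]_n => a *: p.1 + b *: T p.2).
  apply: measurable_fun_cV => i.
  under eq_fun do rewrite !mxE.
  have mc j : measurable_fun setT (fun x : 'cV[R]_n => x j 0 : R).
    exact: measurable_cV_coord.
  apply: measurable_funD; apply: measurable_funM => //.
    exact: measurableT_comp (mc i) measurable_fst.
  exact: measurableT_comp (mc i) mT2.
have mE : measurable E.
  apply: measurableI; apply: measurable_cV_preimage => //.
  by have := mlin 1 1; under eq_fun do rewrite !scale1r.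
have mE' : measurable E'.
  apply: measurableI; apply: measurable_cV_preimage => //.
  by have := mlin (- 1) 1; under eq_fun do rewrite scale1r scaleN1r addrC.
have fub X : measurable X ->
  (\int[mu]_x mu (xsection X x) = \int[mu]_y mu (ysection X y))%E.
  move=> mX; have := @indic_fubini_tonelli _ _ _ _ R mu mu X mX.
  by rewrite indic_fubini_tonelli_FE // indic_fubini_tonelli_GE.
have secc (B : set 'cV[R]_n) (c : \bar R) : measurable B -> (0 <= c)%E ->
   (\int[mu]_y ((\1_B y)%:E * c) = mu B * c)%E.
  move=> mB c0; rewrite ge0_integralZr // ?integral_indic ?setIT //.
  exact: measurableT_comp.
have mTp (B : set 'cV[R]_n) : measurable B -> measurable (T @^-1` B).
  exact: measurable_cV_preimage.
transitivity (\int[mu]_y mu (ysection E' y))%E.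
  rewrite -secc //; last exact: mTp.
  apply: eq_integral => y _; rewrite indicE.
  have [yA|yA] := boolP (y \in _); last first.
    rewrite mul0e (_ : ysection _ _ = set0) ?measure0 //.
    apply/seteqP; split=> // x; rewrite /ysection /= inE => -[/= yA' _].
    by move: yA; rewrite notin_setE.
  rewrite mul1e -(@cV_lebesgue_shift _ _ (- T y)) //.
  move: yA; rewrite inE => yA.
  congr (mu _); apply/seteqP; split=> x; rewrite /ysection /= inE /E' /=.
    by move=> /Csym; rewrite opprB; split.
  by move=> [_ /Csym]; rewrite opprB.
rewrite -fub //.
transitivity (\int[mu]_x mu (xsection E x))%E.
  apply: eq_integral => x _; have [v vx] := Tsurj x.
  rewrite -(@cV_lebesgue_shift _ _ v (xsection E' x)); last first.
    exact: measurable_xsection.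
  by congr (mu _); apply/seteqP; split=> y;
    rewrite /xsection /= !inE /E' /E /= TD vx addrK addrC.
rewrite fub // muleC -secc //; last exact: mTp.
apply: eq_integral => y _; rewrite indicE.
have [yC|yC] := boolP (y \in _); last first.
  rewrite mul0e (_ : ysection _ _ = set0) ?measure0 //.
  apply/seteqP; split=> // x; rewrite /ysection /= inE => -[/= _ yC'].
  by move: yC; rewrite notin_setE.
rewrite mul1e -(@cV_lebesgue_shift _ _ (T y) A) //.
move: yC; rewrite inE => yC.
by congr (mu _); apply/seteqP; split=> x; rewrite /ysection /= inE /E /= => // -[].
Qed.

(** If [T] does not increase the measure of the unit cube, then it does not
    increase the measure of any set, so that along the orbit [A, T^-1 A, ...],
    which returns to [A], all measures are equal; symmetrically if it does not
    decrease it. *)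
Lemma cV_lebesgue_preimage_finite_order k (A : set 'cV[R]_n) :
  (forall x, iter k.+1 T x = x) ->
  measurable A -> mu (T @^-1` A) = mu A.
Proof.
move=> Tk mA.
pose m := mu (unit_cube R n); pose c := mu (T @^-1` (unit_cube R n)).
have mE B : measurable B -> (mu (T @^-1` B) * m = mu B * c)%E.
  move=> mB; apply: cV_lebesgue_preimage_proportional => //.
    exact: measurable_unit_cube.
  by move=> x xC i; rewrite mxE normrN.
have mr : m = (2 ^+ n)%:E by exact: unit_cube_measure.
have m0 : (0 < m)%E by rewrite mr lte_fin exprn_gt0.
have mfin : m \is a fin_num by rewrite mr.
have itE j B : iter j.+1 T @^-1` B = T @^-1` (iter j T @^-1` B).
  by apply/seteqP; split=> x; rewrite /= -iterSr.
have mit j B : measurable B -> measurable (iter j T @^-1` B).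
  move=> mB; elim: j => [|j IH] //=; rewrite itE.
  exact: measurable_cV_preimage.
have itk B : iter k T @^-1` (T @^-1` B) = B.
  by apply/seteqP; split=> x; rewrite /= -/(iter k.+1 T x) Tk.
have [cm|mc] := leP c m.
  have le B : measurable B -> (mu (T @^-1` B) <= mu B)%E.
    move=> mB; rewrite -(@lee_pmul2r _ m) // mE //.
    exact: lee_wpmul2l.
  have lei j B : measurable B -> (mu (iter j T @^-1` B) <= mu B)%E.
    move=> mB; elim: j => // j IH; rewrite itE; apply: le_trans IH.
    by apply: le; exact: mit.
  apply/eqP; rewrite eq_le le //=.
  by have := lei k _ (measurable_cV_preimage mT mA); rewrite itk.
have le B : measurable B -> (mu B <= mu (T @^-1` B))%E.
  move=> mB; rewrite -(@lee_pmul2r _ m) // mE //.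
  by apply: lee_wpmul2l => //; exact: ltW.
have lei j B : measurable B -> (mu B <= mu (iter j T @^-1` B))%E.
  move=> mB; elim: j => // j IH; rewrite itE; apply: (le_trans IH).
  by apply: le; exact: mit.
apply/eqP; rewrite eq_le le // andbT.
by have := lei k _ (measurable_cV_preimage mT mA); rewrite itk.
Qed.

End haar.

(** * Measure preserving maps and the completed measure *)

Section measure_preserving_completion.
Local Open Scope ereal_scope.
Context d (X : measurableType d) (R : realType).
Variable mu : {measure set X -> \bar R}.

(** Preimages of a measurable cover of [A] form a cover of [f @^-1` A] with the
    same total measure. *)
Lemma mu_ext_preimage_le (f : X -> X) (A : set X) :
  measurable_fun setT f ->
  (forall B, measurable B -> mu (f @^-1` B) = mu B) ->
  (mu^*)%mu (f @^-1` A) <= (mu^*)%mu A.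
Proof.
move=> mf muf; apply: le_ereal_inf_tmp => _ [F [mF AF] <-].
apply: ereal_inf_lbound; exists (fun k => f @^-1` F k).
  split=> [k|]; first by rewrite -[X in measurable X]setTI; exact: mf.
  by rewrite -preimage_bigcup; exact: preimage_subset.
by apply: eq_eseriesr => k _; rewrite muf.
Qed.

Variables f g : X -> X.
Hypotheses (fK : cancel f g) (gK : cancel g f).
Hypotheses (mf : measurable_fun setT f) (mg : measurable_fun setT g).
Hypothesis muf : forall B, measurable B -> mu (f @^-1` B) = mu B.
Hypothesis mug : forall B, measurable B -> mu (g @^-1` B) = mu B.

Lemma mu_ext_preimage (A : set X) : (mu^*)%mu (f @^-1` A) = (mu^*)%mu A.
Proof.
apply/eqP; rewrite eq_le mu_ext_preimage_le //=.
suff {1}-> : A = g @^-1` (f @^-1` A) by exact: mu_ext_preimage_le.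
by rewrite -comp_preimage (_ : f \o g = id) ?preimage_id //; apply/funext.
Qed.

(** Any test set is [f @^-1` Y'] for some [Y'], so the splitting condition for
    [f @^-1` A] is the one for [A] seen through [f]. *)
Lemma caratheodory_measurable_preimage (A : set X) :
  ((mu^*)%mu).-caratheodory A -> ((mu^*)%mu).-caratheodory (f @^-1` A).
Proof.
move=> mA Y.
have -> : Y = f @^-1` (g @^-1` Y).
  by rewrite -comp_preimage (_ : g \o f = id) ?preimage_id //; apply/funext.
by rewrite preimage_setC -!preimage_setI !mu_ext_preimage.
Qed.

End measure_preserving_completion.

(** * Tilings by the translates of a section *)

Section ge0_integral_sum_cond.
Local Open Scope ereal_scope.
Context d (X : measurableType d) (R : realType).
Variables (mu : {measure set X -> \bar R}) (D : set X).
Variables (I : finType) (P : pred I) (f : I -> X -> \bar R).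
Hypothesis mD : measurable D.
Hypothesis mf : forall i, P i -> measurable_fun D (f i).

(** Extension by 0, which makes the terms measurable for every index of [I]. *)
Let f' i := if P i then f i else cst 0.

Let sum_f' x : \sum_(i | P i) f i x = \sum_i f' i x.
Proof. by rewrite big_mkcond; apply: eq_bigr => i _; rewrite /f'; case: ifP. Qed.

Let mf' i : measurable_fun D (f' i).
Proof.
by rewrite /f'; case: ifP => [/mf //|_]; exact: measurable_cst.
Qed.

Lemma emeasurable_sum_cond : measurable_fun D (fun x => \sum_(i | P i) f i x).
Proof. by rewrite (funext sum_f'); exact: emeasurable_sum. Qed.

Lemma ge0_integral_sum_cond : (forall i x, P i -> D x -> 0 <= f i x) ->
  \int[mu]_(x in D) (\sum_(i | P i) f i x) =
  \sum_(i | P i) \int[mu]_(x in D) f i x.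
Proof.
move=> f0; under eq_integral do rewrite sum_f'.
rewrite ge0_integral_sum //.
  rewrite [RHS]big_mkcond; apply: eq_bigr => i _; rewrite /f'; case: ifP => // _.
  by rewrite integral0.
by move=> i x Dx; rewrite /f'; case: ifP => // Pi; exact: f0.
Qed.

End ge0_integral_sum_cond.

Section tiling.
Context d (X : measurableType d) (R : realType).
Variable mu : {measure set X -> \bar R}.
Context (gT : finGroupType) (G : {group gT}) (act : gT -> X -> X).
Hypothesis act1 : forall x, act 1%g x = x.
Hypothesis actM : forall g h x, g \in G -> h \in G ->
  act (g * h)%g x = act g (act h x).
Hypothesis mact : forall g, g \in G -> measurable_fun setT (act g).
Hypothesis muact : forall g A, g \in G -> measurable A ->
  mu (act g @^-1` A) = mu A.

Lemma group_actK g : g \in G -> cancel (act g) (act g^-1%g).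
Proof. by move=> gG x; rewrite -actM ?groupV // mulVg act1. Qed.

Lemma group_actVK g : g \in G -> cancel (act g^-1%g) (act g).
Proof. by move=> gG x; rewrite -actM ?groupV // mulgV act1. Qed.

Lemma act_image g A : g \in G -> act g @` A = act g^-1%g @^-1` A.
Proof.
move=> gG; apply/seteqP; split=> [_ [x Ax <-]|x Ax] /=; first by rewrite group_actK.
by exists (act g^-1%g x) => //; rewrite group_actVK.
Qed.

Lemma measurable_act_image g A : g \in G -> measurable A -> measurable (act g @` A).
Proof.
move=> gG mA; rewrite act_image // -[X in measurable X]setTI.
by apply: mact; rewrite ?groupV.
Qed.

Local Open Scope ereal_scope.

Lemma integral_act_image g (A : set X) (phi : X -> \bar R) :
  g \in G -> measurable A -> measurable_fun setT phi -> (forall x, 0 <= phi x) ->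
  \int[mu]_(x in act g @` A) phi x = \int[mu]_(x in A) phi (act g x).
Proof.
move=> gG mA mphi phi0.
have mgA := measurable_act_image gG mA.
pose nu := measure_function_pushforward__canonical__measure_function_Measure
  mu (mact gG).
transitivity (\int[nu]_(x in act g @` A) phi x).
  by apply: eq_measure_integral => B mB _; exact/esym/muact.
rewrite ge0_integral_pushforward //; first last.
- exact: measurable_funS mphi.
- exact: mact.
congr integral; apply/seteqP; split=> x /=; last by exists x.
by move=> [y Ay /(can_inj (group_actK gG)) <-].
Qed.

Variable D : set X.
Hypothesis negD : mu.-negligible (~` \bigcup_(g in [set` G]) (act g @` D)).
Hypothesis disD : forall g h, g \in G -> h \in G -> g != h ->
  mu.-negligible ((act g @` D) `&` (act h @` D)).

(** Off the null sets where two translates of [D] meet or where the tiles miss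
    [Omega], the indicator of [Omega] is the sum of those of the tiles
    [act g @` Sigma]. *)
Lemma integral_tiling (Omega Sigma : set X) (phi : X -> \bar R) :
  measurable Omega -> measurable Sigma -> Sigma `<=` D ->
  \bigcup_(g in [set` G]) (act g @` Sigma) `<=` Omega ->
  mu.-negligible (Omega `\` \bigcup_(g in [set` G]) (act g @` Sigma)) ->
  measurable_fun setT phi -> (forall x, 0 <= phi x) ->
  \int[mu]_(x in Omega) phi x =
  \int[mu]_(x in Sigma) (\sum_(g in G) phi (act g x)).
Proof.
move=> mO mS SD SO OS mphi phi0.
pose tile g := phi \_ (act g @` Sigma).
have mtile g : g \in G -> measurable_fun setT (tile g).
  move=> gG; apply/measurable_restrict => //.
    exact: measurable_act_image.
  exact: measurable_funS mphi.
have tile0 g x : 0 <= tile g x by rewrite /tile patchE; case: ifP.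
transitivity (\int[mu]_x (\sum_(g in G) tile g x)).
  rewrite integral_mkcond; apply: ge0_ae_eq_integral => //.
  - apply/measurable_restrict => //; exact: measurable_funS mphi.
  - exact: emeasurable_sum_cond.
  - by move=> x _; rewrite patchE; case: ifP.
  - by move=> x _; exact: sume_ge0.
  have ae_dis : \forall x \ae mu, forall g h : gT, g \in G -> h \in G -> g != h ->
      ~ ((act g @` D) `&` (act h @` D)) x.
    apply: filter_forall => g; apply: filter_forall => h.
    have [gG|gG] := boolP (g \in G); last by apply: aeW.
    have [hG|hG] := boolP (h \in G); last by apply: aeW.
    have [->|gh] := eqVneq g h; first by apply: aeW.
    have := disD gG hG gh; apply: negligibleS => x /= nd.
    by apply: contrapT => nx; apply: nd.
  have ae_cov : \forall x \ae mu,
      ~ (Omega `\` \bigcup_(g in [set` G]) (act g @` Sigma)) x.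
    by apply: negligibleS OS => x /= /contrapT.
  apply: filterS2 ae_dis ae_cov => x dis cov _.
  rewrite patchE; case: ifPn => [|xO]; last first.
    rewrite big1 // => g gG; rewrite /tile patchE ifF //; apply/negbTE.
    apply: contra xO; rewrite !inE => gS; apply: SO; exists g => //.
  rewrite inE => xO.
  have [g gG gx] : (\bigcup_(g in [set` G]) (act g @` Sigma)) x.
    by apply: contrapT => nx; apply: cov.
  rewrite (bigD1 g) //= big1 ?adde0; first by rewrite /tile patchE mem_set.
  move=> h /andP[hG hg]; rewrite /tile patchE memNset // => hx.
  by apply: (dis h g) => //; split; [move: hx|move: gx]; exact: image_subset.
rewrite (ge0_integral_sum_cond (P := mem G) mu measurableT mtile) //.
rewrite (ge0_integral_sum_cond mu (P := mem G)
  (f := fun g x => phi (act g x))) //; last first.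
  by move=> g gG; apply: measurable_funS (measurableT_comp mphi (mact gG)).
apply: eq_bigr => g gG.
by rewrite -integral_act_image // [RHS]integral_mkcond.
Qed.

Lemma measure_tiling (Omega Sigma : set X) :
  measurable Omega -> measurable Sigma -> Sigma `<=` D ->
  \bigcup_(g in [set` G]) (act g @` Sigma) `<=` Omega ->
  mu.-negligible (Omega `\` \bigcup_(g in [set` G]) (act g @` Sigma)) ->
  mu Omega = #|G|%:R%:E * mu Sigma.
Proof.
move=> mO mS SD SO OS.
have := integral_tiling mO mS SD SO OS (measurable_cst 1) (fun=> lee01).
rewrite integral_cst // mul1e => ->.
under eq_integral do rewrite sumEFin sumr_const.
by rewrite integral_cst.
Qed.

Hypothesis mD : measurable D.

(** The tiling correspondence turns every competitor of one problem into a
    competitor of the other with the same value. *)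
Lemma argmax_tiling (phi : X -> \bar R) (M : R) (Omega0 Sigma0 : set X) :
  measurable_fun setT phi -> (forall x, 0 <= phi x) ->
  argmax (fun Omega => \int[mu]_(x in Omega) phi x)
    [set Omega | [/\ measurable Omega, mu Omega = M%:E &
      forall g, g \in G -> act g @` Omega = Omega]] Omega0 ->
  argmax (fun Sigma => \int[mu]_(x in Sigma) \sum_(g in G) phi (act g x))
    [set Sigma | [/\ measurable Sigma, Sigma `<=` D &
      mu Sigma = (M / #|G|%:R)%:E]] Sigma0 ->
  \int[mu]_(x in Omega0) phi x =
  \int[mu]_(x in Sigma0) \sum_(g in G) phi (act g x).
Proof.
move=> mphi phi0 [[mO muO invO] maxO] [[mS SD muS] maxS].
have cG0 : (#|G|%:R != 0 :> R)%R by rewrite pnatr_eq0 -lt0n cardG_gt0.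
apply/eqP; rewrite eq_le; apply/andP; split.
  (* Omega0 is tiled by the translates of its part in D. *)
  have mOD : measurable (Omega0 `&` D) by exact: measurableI.
  have ODD : Omega0 `&` D `<=` D by move=> x [].
  have sub : \bigcup_(g in [set` G]) (act g @` (Omega0 `&` D)) `<=` Omega0.
    by move=> _ [g gG [x [xO _] <-]]; rewrite -(invO _ gG); exists x.
  have neg : mu.-negligible
      (Omega0 `\` \bigcup_(g in [set` G]) (act g @` (Omega0 `&` D))).
    apply: negligibleS negD => x [xO nx] [g gG [y Dy yx]]; apply: nx.
    exists g => //; exists y => //; split=> //.
    have gVG : g^-1%g \in G by rewrite groupV.
    by rewrite -(invO _ gVG); exists x => //; rewrite -yx group_actK.
  rewrite (integral_tiling mO mOD ODD sub neg mphi phi0).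
  apply: maxS; split=> //.
  have := measure_tiling mO mOD ODD sub neg.
  rewrite muO; move: (mu _) => [r| |].
  - by rewrite -EFinM => -[->]; congr (_%:E); field.
  - by rewrite gt0_muley // lte_fin ltr0n cardG_gt0.
  - by rewrite gt0_muleNy // lte_fin ltr0n cardG_gt0.
(* Conversely the orbit of Sigma0 is an invariant set tiled by Sigma0. *)
pose U := \bigcup_(g in [set` G]) (act g @` Sigma0).
have mU : measurable U.
  apply: fin_bigcup_measurable; first exact: finite_finset.
  by move=> g gG; exact: measurable_act_image.
have neg : mu.-negligible (U `\` U) by rewrite setDv; exact: negligible_set0.
rewrite -(integral_tiling mU mS SD (@subset_refl _ U) neg mphi phi0).
apply: maxO; split=> //.
  rewrite (measure_tiling mU mS SD (@subset_refl _ U) neg) muS -EFinM.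
  by congr (_%:E); field.
move=> g gG; apply/seteqP; split=> [_ [_ [h hG [x xS <-]] <-]|_ [h hG [x xS <-]]].
  by exists (g * h)%g; [exact: groupM|exists x => //; rewrite actM].
exists (act (g^-1 * h)%g x).
  by exists (g^-1 * h)%g; [rewrite /= groupM // groupV|exists x].
by rewrite -actM ?groupM ?groupV // mulKVg.
Qed.

End tiling.

(** * The linear action of the group *)

Section lattice_action.
Context (R : realType) (gT : finGroupType) (G : {group gT}) (d : nat).
Context (rG : mx_representation R G d).

Lemma lin_act1 x : lin_act rG 1%g x = x.
Proof. by rewrite /lin_act repr_mx1 mul1mx. Qed.

Lemma lin_actM g h x : g \in G -> h \in G ->
  lin_act rG (g * h)%g x = lin_act rG g (lin_act rG h x).
Proof. by move=> gG hG; rewrite /lin_act repr_mxM // mulmxA. Qed.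

Lemma measurable_mulmx (T : 'M[R]_d) :
  measurable_fun setT (fun x : 'cV[R]_d => T *m x).
Proof.
apply: measurable_fun_cV => i; under eq_fun do rewrite mxE.
apply: measurable_sum => j; apply: measurable_funM => //.
exact: measurable_cV_coord.
Qed.

Lemma cV_lebesgue_lin_act g (A : set 'cV[R]_d) : g \in G -> measurable A ->
  cV_lebesgue R d ((fun x : 'cV[R]_d => rG g *m x) @^-1` A) = cV_lebesgue R d A.
Proof.
move=> gG mA.
apply: (@cV_lebesgue_preimage_finite_order _ _ _ _ _ _ #[g]%g.-1) => //.
- exact: measurable_mulmx.
- by move=> x y; rewrite mulmxDr.
- move=> x; exists (rG g^-1%g *m x).
  by rewrite mulmxA -repr_mxM ?groupV // mulgV repr_mx1 mul1mx.
move=> x; have itE k : iter k (fun x : 'cV[R]_d => rG g *m x) x = rG (g ^+ k)%g *m x.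
  elim: k => [|k IH]; first by rewrite expg0 repr_mx1 mul1mx.
  by rewrite iterS IH mulmxA -repr_mxM ?groupX // -expgS.
by rewrite itE prednK ?order_gt0 // expg_order repr_mx1 mul1mx.
Qed.

Lemma measurable_lin_act g : g \in G -> measurable_fun setT (lin_act rG g).
Proof.
move=> gG _ A mA; rewrite setTI.
apply: (@caratheodory_measurable_preimage _ _ _ (cV_lebesgue R d)
  (lin_act rG g) (lin_act rG g^-1%g)) => //.
- exact: (group_actK lin_act1 lin_actM).
- exact: (group_actVK lin_act1 lin_actM).
- exact: measurable_mulmx.
- exact: measurable_mulmx.
- by move=> B mB; exact: cV_lebesgue_lin_act.
- by move=> B mB; apply: cV_lebesgue_lin_act => //; rewrite groupV.
Qed.

Lemma lebesgue_lin_act g (A : set (lebesgue_space R d)) : g \in G ->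
  lebesgue (lin_act rG g @^-1` A) = lebesgue A.
Proof.
move=> gG; apply: (@mu_ext_preimage _ _ _ (cV_lebesgue R d)
  (lin_act rG g) (lin_act rG g^-1%g)) => //.
- exact: (group_actVK lin_act1 lin_actM).
- exact: measurable_mulmx.
- exact: measurable_mulmx.
- by move=> B mB; exact: cV_lebesgue_lin_act.
- by move=> B mB; apply: cV_lebesgue_lin_act => //; rewrite groupV.
Qed.

End lattice_action.

Lemma measurable_normc_sqr (R : realType) (d : nat)
    (F : lebesgue_space R d -> R[i]) :
  cmeasurable F -> measurable_fun setT (fun x => Normc.normc (F x) ^+ 2).
Proof.
move=> [mRe mIm].
rewrite (_ : (fun x => _) =
  fun x => complex.Re (F x) ^+ 2 + complex.Im (F x) ^+ 2); last first.
  apply/funext => x; case: (F x) => a b /=.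
  by rewrite sqr_sqrtr // addr_ge0 ?sqr_ge0.
by apply: measurable_funD; exact: measurable_funX.
Qed.

Theorem theorem14 (R : realType) (d : nat) (gT : finGroupType) (G : {group gT})
    (rG : mx_representation R G d) (hfaithful : mx_faithful rG)
    (hlattice : forall g, g \in G -> lin_act rG g @` @int_lattice R d = @int_lattice R d)
    (M : R) (hM : 0 < M)
    (m : nat) (f fhat : 'I_m -> lebesgue_space R d -> R[i])
    (hf : forall i, cLp 2%:E (f i))
    (hfhat : forall i, is_fourierL2 (f i) (fhat i))
    (D : set (lebesgue_space R d)) (hD : is_section rG D)
    (Omega0 Sigma0 : set (lebesgue_space R d)) :
  let mu := @lebesgue R d in
  let phi (xi : lebesgue_space R d) : R :=
    \sum_(i < m) Normc.normc (fhat i xi) ^+ 2 in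
  let PhiG (xi : lebesgue_space R d) : R :=
    \sum_(g in G) \sum_(i < m) Normc.normc (fhat i (lin_act rG g xi)) ^+ 2 in
  let MM : set (set (lebesgue_space R d)) :=
    [set Omega | [/\ measurable Omega, mu Omega = M%:E &
                     forall g, g \in G -> lin_act rG g @` Omega = Omega]] in
  argmax (fun Omega => \int[mu]_(xi in Omega) (phi xi)%:E)%E MM Omega0 ->
  argmax (fun Sigma => \int[mu]_(xi in Sigma) (PhiG xi)%:E)%E
    [set Sigma | [/\ measurable Sigma, Sigma `<=` D & mu Sigma = (M / #|G|%:R)%:E]]
    Sigma0 ->
  (\int[mu]_(xi in Omega0) (phi xi)%:E = \int[mu]_(xi in Sigma0) (PhiG xi)%:E)%E.
Proof.
move=> mu phi PhiG MM maxO maxS.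
have [mD negD disD] := hD.
have mphi : measurable_fun setT (fun x => (phi x)%:E).
  apply/measurable_EFinP; apply: measurable_sum => i.
  by apply: measurable_normc_sqr; have [[]] := hfhat i.
have phi0 x : (0 <= (phi x)%:E)%E.
  by rewrite lee_fin sumr_ge0 // => i _; exact: sqr_ge0.
have PhiE x : (PhiG x)%:E = (\sum_(g in G) (phi (lin_act rG g x))%:E)%E.
  by rewrite sumEFin.
under [RHS]eq_integral do rewrite PhiE.
apply: (argmax_tiling (D := D) (@lin_act1 _ _ _ _ rG) (@lin_actM _ _ _ _ rG)
  (@measurable_lin_act _ _ _ _ rG) _ negD disD mD mphi phi0 maxO).
  by move=> g A gG _; exact: lebesgue_lin_act.
by move: maxS; under eq_fun do under eq_integral do rewrite PhiE.
Qed.
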